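(* Let $F$ be a nonempty Motzkin set in $\mathbb{R}^n$, represented as $F=K+D=K+0^+F$ with $K$ compact and $D=0^+F$ a closed convex cone. Then the following are equivalent: (1) $F$ is a FW-set. (2) The recession cone $0^+F$ of $F$ is polyhedral. (3) $F$ has no $f$-asymptotes.
   Context: A closed set $F\subset\mathbb{R}^n$ is called a Motzkin set if it can be written as a Minkowski sum $F=K+D$, where $K$ is a compact set (not necessarily convex) and $D$ is a closed convex cone. The recession cone of $F$ is $0^+F=\{u\in\mathbb{R}^n: x+tu\in F\text{ for all }x\in F\text{ and all }t\ge0\}$; for a nonempty Motzkin set $F=K+D$ the cone $D$ is uniquely determined and equals $0^+F$. A function $f:\mathbb{R}^n\to\mathbb{R}$ is quadratic if $f(x)=\frac12x^{T}Ax+b^{T}x+c$ with $A=A^{T}\in\mathbb{R}^{n\times n}$, $b\in\mathbb{R}^n$, $c\in\mathbb{R}$. A set $F\subset\mathbb{R}^n$ is a FW-set (Frank-and-Wolfe set) if every quadratic function which is bounded below on $F$ attains its infimum on $F$. An affine manifold is a nonempty affine subspace of $\mathbb{R}^n$ (single points are allowed). An affine manifold $M$ is an $f$-asymptote of $F$ if $F\cap M=\emptyset$ and $\mathrm{dist}(F,M)=\inf\{\|x-y\|:x\in F,\ y\in M\}=0$. Polyhedral means being a finite intersection of closed half-spaces. *)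

(* Defs.v *)
From HB Require Import structures.
From mathcomp Require Import all_boot all_order all_algebra.
From mathcomp Require Import all_classical all_reals all_analysis.

Set Implicit Arguments.
Unset Strict Implicit.
Unset Printing Implicit Defensive.

Import Order.TTheory GRing.Theory Num.Theory.
Import numFieldNormedType.Exports.

Local Open Scope classical_set_scope.
Local Open Scope ring_scope.

(* Points of R^n are row vectors, so x^T A x reads x *m A *m x^T.  [closed] and
   [compact] refer to the library topology of matrices; it is the one of the
   max norm, i.e. the usual topology of R^n. *)

Definition dot (R : realType) (n : nat) (x y : 'rV[R]_n) : R :=
  (x *m y^T) 0 0.

(* Euclidean norm; the library norm `|x| on matrices is the max norm. *)
Definition enorm (R : realType) (n : nat) (x : 'rV[R]_n) : R :=
  Num.sqrt (dot x x).

(* Extended-real valued, so that the distance to the empty set is +oo. *)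
Definition set_dist (R : realType) (n : nat) (F M : set 'rV[R]_n) : \bar R :=
  ereal_inf [set (enorm (x - y))%:E | x in F & y in M].

Definition minkowski_sum (R : realType) (n : nat) (K D : set 'rV[R]_n) :
    set 'rV[R]_n :=
  [set x + y | x in K & y in D].

(* [convex_lmodType] is the carrier alias on which the library puts the
   convex-space structure of a module. *)
Definition closed_convex_cone (R : realType) (n : nat) (D : set 'rV[R]_n) :
    Prop :=
  [/\ D !=set0,
      closed D,
      convex_set (D : set (convex_lmodType 'rV[R]_n))
    & forall (t : R) (x : 'rV[R]_n), 0 <= t -> D x -> D (t *: x)].

Definition motzkin_set (R : realType) (n : nat) (F : set 'rV[R]_n) : Prop :=
  closed F /\
  exists K D : set 'rV[R]_n,
    [/\ compact K, closed_convex_cone D & F = minkowski_sum K D].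

Definition recession_cone (R : realType) (n : nat) (F : set 'rV[R]_n) :
    set 'rV[R]_n :=
  [set u | forall (x : 'rV[R]_n) (t : R), F x -> 0 <= t -> F (x + t *: u)].

Definition quadratic (R : realType) (n : nat) (f : 'rV[R]_n -> R) : Prop :=
  exists (A : 'M[R]_n) (b : 'rV[R]_n) (c : R),
    A^T = A /\
    forall x, f x = 2^-1 * (x *m A *m x^T) 0 0 + dot b x + c.

Definition FW_set (R : realType) (n : nat) (F : set 'rV[R]_n) : Prop :=
  forall f : 'rV[R]_n -> R, quadratic f ->
    has_lbound (f @` F) -> exists2 x, F x & f x = inf (f @` F).

Definition affine_manifold (R : realType) (n : nat) (M : set 'rV[R]_n) : Prop :=
  exists (p : 'rV[R]_n) (L : {vspace 'rV[R]_n}),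
    M = [set p + v | v in [set` L]].

Definition f_asymptote (R : realType) (n : nat) (F M : set 'rV[R]_n) : Prop :=
  [/\ affine_manifold M, F `&` M = set0 & set_dist F M = 0%E].

Definition closed_half_space (R : realType) (n : nat) (H : set 'rV[R]_n) :
    Prop :=
  exists (a : 'rV[R]_n) (b : R), a != 0 /\ H = [set x | dot a x <= b].

(* The empty intersection (m = 0) is the whole space. *)
Definition polyhedral (R : realType) (n : nat) (P : set 'rV[R]_n) : Prop :=
  exists (m : nat) (H : 'I_m -> set 'rV[R]_n),
    (forall i, closed_half_space (H i)) /\ P = \bigcap_i H i.

(* Main.v *)
Require Import Defs.
From mathcomp Require Import all_boot all_order all_algebra.
From mathcomp Require Import all_classical all_reals all_analysis.
From mathcomp Require Import zify ring lra.
Import Order.TTheory GRing.Theory Num.Theory.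
Import numFieldNormedType.Exports.
Local Open Scope classical_set_scope.
Local Open Scope ring_scope.

(** Let [F = K + D] with [K] compact and [D] a closed convex cone; [D] is the
    recession cone.  The three properties are linked by the cycle: [D]
    polyhedral => [F] is a FW-set => [F] has no f-asymptote => [D] polyhedral.

    [D] polyhedral => FW ([polar_cone_FW]).  Among the pairs in [K * D] whose sum
    is an approximate minimiser, choose [(x_k, y_k)] with [y_k] nearly as short
    as possible.  If the [y_k] stay bounded, a limit point is a minimiser.
    Otherwise let [h] be a limit of their directions.  Boundedness below makes
    the quadratic form vanish at [h] and makes [f] nondecreasing along [h] from
    every point of [F], so that replacing [y_k] by [y_k - h] does not increase
    [f].  It shortens [y_k] by a definite amount, and it stays in [D] because [D]
    is polyhedral: an inequality that is tight at [h] is unaffected, one that is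
    strict at [h] has unbounded slack at [y_k].  This contradicts the choice of
    [y_k].

    FW => no f-asymptote ([FW_no_asymptote]).  If [M = p + L] is an f-asymptote,
    the quadratic function [x |-> |(x - p) P|^2], where the kernel of [P] is [L],
    has infimum 0 on [F] and is positive there.

    No f-asymptote => [D] polyhedral ([no_asymptote_polar_cone]).  The absence of
    f-asymptotes means that all sums [F + L] with linear subspaces [L] are
    closed.  The compact summand can be cancelled ([compact_cone_cancel]), so all
    [D + L] are closed.  By Mirkil's theorem ([closed_sums_conic]) the cone [D]
    is then finitely generated: by induction on the codimension of [L], for
    [u] in [D + L] outside [L] the cone [D + L + R u], the tangent cone at [u],
    is finitely generated; hence [D + L] is finitely generated near [u], and
    compactness of a unit sphere leaves finitely many generators.  Finally,
    Weyl's theorem ([weyl]) turns generators into inequalities. *)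

Set Implicit Arguments.
Unset Strict Implicit.
Unset Printing Implicit Defensive.

(** * The scalar product *)

Section Dot.
Context {R : realType} {n : nat}.
Implicit Types (a x y z : 'rV[R]_n) (t : R).

Lemma dotE x y : dot x y = \sum_i x 0 i * y 0 i.
Proof. by rewrite /dot mxE; apply: eq_bigr => i _; rewrite mxE. Qed.

Lemma dotC x y : dot x y = dot y x.
Proof. by rewrite !dotE; apply: eq_bigr => i _; rewrite mulrC. Qed.

Lemma dotDl x y z : dot (x + y) z = dot x z + dot y z.
Proof. by rewrite /dot mulmxDl mxE. Qed.

Lemma dotZl t x y : dot (t *: x) y = t * dot x y.
Proof. by rewrite /dot -scalemxAl mxE. Qed.

Lemma dotDr x y z : dot x (y + z) = dot x y + dot x z.
Proof. by rewrite dotC dotDl !(dotC x). Qed.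

Lemma dotZr t x y : dot x (t *: y) = t * dot x y.
Proof. by rewrite dotC dotZl dotC. Qed.

Lemma dotNl x y : dot (- x) y = - dot x y.
Proof. by rewrite -scaleN1r dotZl mulN1r. Qed.

Lemma dotNr x y : dot x (- y) = - dot x y.
Proof. by rewrite -scaleN1r dotZr mulN1r. Qed.

Lemma dot0l x : dot 0 x = 0.
Proof. by rewrite /dot mul0mx mxE. Qed.

Lemma dot0r x : dot x 0 = 0.
Proof. by rewrite dotC dot0l. Qed.

Definition dot_linE := (dotDl, dotDr, dotZl, dotZr, dotNl, dotNr, dot0l, dot0r).

Lemma dot_sym_mx (A : 'M[R]_n) x y : A^T = A -> dot (x *m A) y = dot (y *m A) x.
Proof. by move=> AT; rewrite dotC /dot trmx_mul AT mulmxA. Qed.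

Lemma dot_delta x i : dot (delta_mx 0 i) x = x 0 i.
Proof.
rewrite dotE (bigD1 i) //= big1 ?addr0 => [|j ji]; first by rewrite mxE !eqxx mul1r.
by rewrite mxE eqxx (negPf ji) mul0r.
Qed.

Lemma dot_ge0 x : 0 <= dot x x.
Proof. by rewrite dotE sumr_ge0// => i _; rewrite -expr2 sqr_ge0. Qed.

Lemma dot_eq0 x : dot x x = 0 -> x = 0.
Proof.
rewrite dotE => /eqP; rewrite psumr_eq0 => [/allP x0|i _]; last first.
  by rewrite -expr2 sqr_ge0.
apply/rowP => i; rewrite mxE; apply/eqP.
by have := x0 i (mem_index_enum i); rewrite /= mulf_eq0 orbb.
Qed.

Lemma dot_gt0 x : x != 0 -> 0 < dot x x.
Proof.
move=> x0; rewrite lt_neqAle dot_ge0 andbT eq_sym.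
by apply: contra x0 => /eqP/dot_eq0/eqP.
Qed.

Context {T : Type} {U : set_system T} {FU : Filter U}.

Lemma cvg_coord (f : T -> 'rV[R]_n) x i :
  f @ U --> x -> (f k 0 i) @[k --> U] --> x 0 i.
Proof.
move=> fx.
exact: (cvg_comp f (fun M : 'rV[R]_n => M 0 i) fx (@coord_continuous _ _ _ _ _ _)).
Qed.

Lemma cvg_dot (f g : T -> 'rV[R]_n) x y :
  f @ U --> x -> g @ U --> y -> dot (f k) (g k) @[k --> U] --> dot x y.
Proof.
move=> fx gy; rewrite dotE (_ : (fun _ => _) = fun k => \sum_i f k 0 i * g k 0 i).
  apply: (@cvg_big _ _ +%R) => [|i _]; first exact: add_continuous.
  by apply: cvgM; exact: cvg_coord.
by apply/funext => k; rewrite dotE.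
Qed.

Lemma cvg_mulmx (A : 'M[R]_n) (f : T -> 'rV[R]_n) x :
  f @ U --> x -> (f k *m A) @[k --> U] --> x *m A.
Proof.
move=> fx; rewrite mulmx_sum_row.
rewrite (_ : (fun _ => _) = fun k => \sum_i f k 0 i *: row i A).
  apply: (@cvg_big 'rV[R]_n _ +%R) => [|i _]; first exact: add_continuous.
  by apply: cvgZr_tmp; exact: cvg_coord.
by apply/funext => k; rewrite mulmx_sum_row.
Qed.

End Dot.

(** * Finitely generated cones and Weyl's theorem *)

Section Cones.
Context {R : realType} {n : nat}.
Implicit Types (C D : set 'rV[R]_n) (G A : seq 'rV[R]_n) (x y g : 'rV[R]_n) (t : R).

Definition convex_cone C :=
  [/\ C 0, forall x y, C x -> C y -> C (x + y)
    & forall t x, 0 <= t -> C x -> C (t *: x)].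

Fixpoint conic G : set 'rV[R]_n :=
  if G is g :: G' then [set x | exists2 t, 0 <= t & conic G' (x - t *: g)]
  else [set 0].

Definition polar_cone A : set 'rV[R]_n := [set x | forall a, a \in A -> dot a x <= 0].

Lemma conic_min C G : convex_cone C -> (forall g, g \in G -> C g) -> conic G `<=` C.
Proof.
case=> C0 CD CZ; elim: G => [_ _ ->//|g G IH CG x /= [t t0 /IH Cx]].
rewrite -(subrK (t *: g) x); apply: CD.
  by apply: Cx => h hG; apply: CG; rewrite inE hG orbT.
by apply: CZ => //; apply: CG; rewrite inE eqxx.
Qed.

Lemma conic_cone G : convex_cone (conic G).
Proof.
elim: G => [|g G [C0 CD CZ]].
  by split=> [//|x y -> ->|t x _ ->] /=; rewrite ?addr0 ?scaler0.
split=> [|x y [s s0 xs] [t t0 yt]|t x t0 [s s0 xs]] /=.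
- by exists 0 => //; rewrite scale0r subr0.
- by exists (s + t); rewrite ?addr_ge0// scalerDl opprD addrACA; exact: CD.
- by exists (t * s); rewrite ?mulr_ge0// -scalerA -scalerBr; exact: CZ.
Qed.

Lemma conic_mem G g : g \in G -> conic G g.
Proof.
elim: G => // h G IH; rewrite inE => /predU1P[->|/IH Gg] /=.
  by exists 1 => //; rewrite scale1r subrr; have [] := conic_cone G.
by exists 0 => //; rewrite scale0r subr0.
Qed.

Lemma polar_cone_cone A : convex_cone (polar_cone A).
Proof.
split=> [a _|x y Ax Ay a aA|t x t0 Ax a aA]; rewrite !dot_linE//.
  by have := Ax a aA; have := Ay a aA; lra.
by rewrite mulr_ge0_le0 ?Ax.
Qed.

(** The one-dimensional Helly theorem for two families of rays. *)
Lemma exists_between (L U : seq R) :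
  (forall l u, l \in L -> u \in U -> l <= u) ->
  exists t, (forall l, l \in L -> l <= t) /\ (forall u, u \in U -> t <= u).
Proof.
elim: L => [_|l L IH LU].
  elim: U => [|u U [t [_ tU]]]; first by exists 0.
  exists (Num.min u t); split=> // v; rewrite inE ge_min => /predU1P[->|/tU->].
    by rewrite lexx.
  by rewrite orbT.
have [l' u l'L uU|t [Lt tU]] := IH; first by apply: LU; rewrite // inE l'L orbT.
exists (Num.max l t); split=> [k|u uU].
  by rewrite inE le_max => /predU1P[->|/Lt->]; rewrite ?lexx ?orbT.
by rewrite ge_max tU// LU// inE eqxx.
Qed.

(** Fourier-Motzkin elimination of [t] from the system [x - t *: g \in polar_cone A]:
    the inequalities in which [t] has a positive (negative) coefficient bound it
    from below (above), and a [t] exists when each lower bound is at most each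
    upper bound, 0 being one more lower bound. *)
Lemma fourier_motzkin A g : exists B, forall x,
  polar_cone B x <-> exists2 t, 0 <= t & polar_cone A (x - t *: g).
Proof.
pose comb a b := dot a g *: b - dot b g *: a.
(* The first part also says that the upper bounds are nonnegative. *)
exists ([seq a <- A | dot a g <= 0] ++
  [seq comb a b | a <- [seq a <- A | 0 < dot a g], b <- [seq b <- A | dot b g < 0]]).
move=> x; split=> [Bx|[t t0 Ax] b].
  pose r a := dot a x / dot a g.
  have [|t [Lt tU]] := @exists_between (0 :: [seq r a | a <- A & 0 < dot a g])
      [seq r b | b <- A & dot b g < 0].
    move=> l u lL /mapP[b]; rewrite mem_filter => /andP[bg bA] ->.
    move: lL; rewrite inE => /predU1P[->|/mapP[a]].
      rewrite /r ler_ndivlMr// mul0r; apply: Bx.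
      by rewrite mem_cat mem_filter bA ltW.
    rewrite mem_filter => /andP[ag aA] ->.
    rewrite /r ler_pdivrMr// mulrAC ler_ndivlMr//.
    have : dot (comb a b) x <= 0.
      apply: Bx; rewrite mem_cat; apply/orP; right.
      by apply/allpairsP; exists (a, b); rewrite /= !mem_filter ag bg aA bA.
    rewrite /comb !dot_linE; lra.
  exists t => [|a aA]; first by apply: Lt; rewrite inE eqxx.
  rewrite !dot_linE.
  have [ag|ag|ag] := ltgtP (dot a g) 0.
  - have := tU (r a); rewrite map_f ?mem_filter ?ag// => /(_ isT).
    by rewrite /r ler_ndivlMr//; lra.
  - have := Lt (r a); rewrite inE map_f ?mem_filter ?ag// orbT => /(_ isT).
    by rewrite /r ler_pdivrMr//; lra.
  - by rewrite ag mulr0 subr0; apply: Bx; rewrite mem_cat mem_filter aA ag lexx.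
rewrite mem_cat => /orP[|/allpairsP[[a c]]]/=.
  rewrite mem_filter => /andP[bg /Ax]; rewrite !dot_linE; nra.
rewrite !mem_filter => -[/andP[ag /Ax ax] /andP[cg /Ax cx] ->].
by move: ax cx; rewrite /comb !dot_linE; nra.
Qed.

(** Weyl's theorem.  Adding the generator [g] to a cone amounts to eliminating
    one variable, so that the inequalities are found one generator at a time,
    starting from those of [0]. *)
Lemma weyl G : exists A, conic G = polar_cone A.
Proof.
elim: G => [|g G [A GA]].
  pose E : seq 'rV[R]_n := [seq delta_mx 0 i | i <- enum 'I_n]
                        ++ [seq - delta_mx 0 i | i <- enum 'I_n].
  exists E.
  apply/seteqP; split=> [x -> a _|x Ax]; first by rewrite dot0r.
  apply/rowP => i; apply/eqP; rewrite mxE eq_le.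
  have /Ax : delta_mx 0 i \in E by rewrite mem_cat map_f ?mem_enum.
  have /Ax : - delta_mx 0 i \in E.
    by rewrite mem_cat (map_f (fun i => - delta_mx 0 i)) ?mem_enum ?orbT.
  by rewrite dotNl dot_delta oppr_le0 => -> ->.
have [B AB] := fourier_motzkin A g; exists B.
by apply/seteqP; split=> x; rewrite AB /= GA.
Qed.

End Cones.

(** * Compactness *)

(** The finite subcover property, phrased for choosing finitely many witnesses
    of a property that holds locally. *)
Lemma compact_finite_choice (T : ptopologicalType) (I : choiceType) (S : set T)
    (P : set I) (Q : T -> I -> Prop) :
  compact S -> (forall x, S x -> exists2 i, P i & \forall y \near x, Q y i) ->
  exists2 s : seq I, (forall i, i \in s -> P i) &
    forall x, S x -> exists2 i, i \in s & Q x i.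
Proof.
rewrite compact_cover => cS SQ.
have [|x Sx|s sP Ss] := cS I P (fun i => interior [set y | Q y i]).
- by move=> i _; exact: open_interior.
- by have [i Pi Qi] := SQ x Sx; exists i.
exists (finmap.enum_fset s) => [i /sP|x /Ss[i si /interior_subset Qi]].
  by rewrite inE.
by exists i.
Qed.

(** Along an ultrafilter, bounded sequences converge outright; this replaces
    the extraction of subsequences. *)
Lemma compact_ultra_cvg (T : Type) (X : topologicalType) (U : set_system T)
    (S : set X) (f : T -> X) : UltraFilter U -> compact S ->
  (\forall k \near U, S (f k)) -> exists2 p, S p & f @ U --> p.
Proof.
move=> UU; rewrite compact_ultra => cS Sf.
have [|p [Sp fp]] := cS (f @ U) _ Sf; last by exists p.
apply: Build_UltraFilter => G GG UG; apply/seteqP; split=> [B GB|]; last exact: UG.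
have [//|UB] := @in_ultra_setVsetC _ U (f @^-1` B) UU.
have : G (B `&` ~` B) by apply: filterI => //; exact: UG.
by rewrite setICr => /filter_not_empty.
Qed.

Lemma near_all (T : Type) (J : eqType) (F : set_system T) (s : seq J)
    (P : J -> T -> Prop) : Filter F ->
  (forall i, i \in s -> \forall x \near F, P i x) ->
  \forall x \near F, forall i, i \in s -> P i x.
Proof.
move=> FF; elim: s => [_|i s IH Ps]; first exact: nearW.
have Pi : \forall x \near F, P i x by apply: Ps; rewrite inE eqxx.
have Ps' : \forall x \near F, forall i, i \in s -> P i x.
  by apply: IH => j js; apply: Ps; rewrite inE js orbT.
by near=> x => j; rewrite inE => /predU1P[->|]; [near: x|move: j; near: x].
Unshelve. all: end_near. Qed.

(** * Separation and cancellation *)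

Section Separation.
Context {R : realType} {n : nat}.
Implicit Types (C D K : set 'rV[R]_n) (G A : seq 'rV[R]_n) (a x y g : 'rV[R]_n) (t : R).

Lemma continuous_dot a : continuous (dot a).
Proof.
move=> x; apply: (@cvg_dot _ _ _ (nbhs x) _ (fun=> a) id) => //; exact: cvg_cst.
Qed.

Lemma closed_dot_eq a t : closed [set x | dot a x = t].
Proof.
apply: (@preimage_closed _ _ (dot a) [set y | y = t]); last exact: closed_eq.
by move=> x _; exact: continuous_dot.
Qed.

Lemma compact_ball (B : R) : compact [set x : 'rV[R]_n | `|x| <= B].
Proof.
apply: bounded_closed_compact.
  by exists B; split=> [|M BM x /= xB]; [exact: num_real|exact: le_trans (ltW BM)].
apply: (@preimage_closed 'rV[R]_n R Num.norm [set y : R | y <= B]); last exact: closed_le.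
by move=> x _; exact: norm_continuous.
Qed.

Lemma compact_sphere : compact [set x : 'rV[R]_n | `|x| = 1].
Proof.
rewrite (_ : [set _ | _] = [set x | `|x| <= 1] `&` [set x | `|x| = 1]).
  apply: compact_closedI; first exact: compact_ball.
  apply: (@preimage_closed 'rV[R]_n R Num.norm [set y : R | y = 1]); last exact: closed_eq.
  by move=> x _; exact: norm_continuous.
by apply/seteqP; split=> x /= [] // ->.
Qed.

(** If no nonzero [a] worked, then every [a] on the unit sphere would be negative at some point of [C]; by compactness finitely
    many points of [C] suffice, and by Weyl's theorem these generate the whole
    space. *)
Lemma convex_cone_halfspace C e : convex_cone C -> ~ C e ->
  exists2 a, a != 0 & forall c, C c -> 0 <= dot a c.
Proof.
move=> cC Ce; apply: contrapT => noa.
have [|s sC sS] := @compact_finite_choice _ _ _ C (fun a c => dot a c < 0) compact_sphere.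
  move=> a a1; apply: contrapT => noc; apply: noa; exists a.
    by rewrite -normr_eq0 a1 oner_neq0.
  move=> c Cc; rewrite leNgt; apply/negP => ac; apply: noc; exists c => //.
  have : (fun a => dot a c) @ a --> dot a c.
    by apply: (@cvg_dot _ _ _ (nbhs a) _ id (fun=> c)) => //; exact: cvg_cst.
  by move=> /cvgr_lt; apply.
have [A sA] := weyl s.
have A0 a : a \in A -> a = 0.
  move=> aA; apply/eqP; apply: contrapT => /negP a0.
  have [|c cs] := sS (- (`|a|^-1 *: a)).
    by rewrite /= normrN normrZ normfV normr_id mulVf ?normr_eq0.
  rewrite dotNl dotZl oppr_lt0 pmulr_rgt0 ?invr_gt0 ?normr_gt0//.
  by have := conic_mem cs; rewrite sA => /(_ a aA); rewrite ltNge => ->.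
apply: Ce; apply: (conic_min cC sC); rewrite sA => a /A0 ->; by rewrite dot0l.
Qed.

Lemma orthogonal_vspace a : exists W : {vspace 'rV[R]_n},
  forall x, (x \in W) = (dot a x == 0).
Proof.
exists (lker (linfun (mulmxr a^T : 'rV[R]_n -> 'rV[R]_1))) => x.
rewrite memv_ker lfunE /= dotC /dot; apply/eqP/eqP => [->|xa]; first by rewrite mxE.
by apply/rowP => i; rewrite ord1 xa mxE.
Qed.

(** Let [e] be in [E] but not in [C].  A half-space separates them: some [a] is
    nonnegative on [C] and nonpositive at [e].  Let [k0] minimise [a] on [K].  Comparing the values of [a] on both sides of
    [k0 + x = k + c] shows that [a] is nonnegative on [E], so that it vanishes
    at [e].  The hypothesis is inherited by the parts of [C] and [E] where [a]
    vanishes and the part of [K] where [a] is minimal, and one concludes by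
    induction on the dimension of a subspace [V] containing both cones. *)
Lemma compact_cone_cancel K C E : K !=set0 -> compact K ->
  convex_cone C -> convex_cone E ->
  minkowski_sum K E `<=` minkowski_sum K C -> E `<=` C.
Proof.
move=> K0 cK cC cE KEC.
have [V [CV EV]] : exists V : {vspace 'rV[R]_n}, C `<=` [set` V] /\ E `<=` [set` V].
  by exists fullv; split=> x _; exact: memvf.
have [r Vr] := ubnP (\dim V).
elim: r => // r IH in K C E V K0 cK cC cE KEC CV EV Vr *.
move=> e Ee; apply: contrapT => Ce.
(* Adding a complement of [V] forces [a] to vanish there, hence not to vanish
   on all of [V], which makes the dimension drop. *)
pose C' : set 'rV[R]_n := [set x | exists c t w,
  [/\ C c, 0 <= t, w \in (V^C)%VS & x = c - t *: e + w]].
have [C0 CD CZ] := cC.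
have cC' : convex_cone C'.
  split.
  - by exists 0, 0, 0; split; rewrite ?mem0v// scale0r subrr addr0.
  - move=> _ _ [c [t [w [Cc t0 wV ->]]]] [c' [t' [w' [Cc' t'0 wV' ->]]]].
    exists (c + c'), (t + t'), (w + w'); split; rewrite ?addr_ge0 ?memvD//.
      exact: CD.
    by rewrite scalerDl opprD addrACA [X in X + _]addrACA.
  - move=> s _ s0 [c [t [w [Cc t0 wV ->]]]].
    exists (s *: c), (s * t), (s *: w); split; rewrite ?mulr_ge0 ?memvZ//.
      exact: CZ.
    by rewrite scalerDr scalerBr scalerA.
have C'e : ~ C' e.
  move=> [c [t [w [Cc t0 wV ee]]]].
  have ew : (1 + t) *: e - c = w.
    by rewrite scalerDl scale1r {1}ee [c - _ + w + _]addrAC subrK [c + w]addrC addrK.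
  have w0 : w = 0.
    apply/eqP; rewrite -memv0 -(capv_compl V) memv_cap wV andbT -ew.
    by apply: memvB; [apply: memvZ; exact: EV|exact: CV].
  have ec : e = (1 + t)^-1 *: c.
    move/eqP: ew; rewrite w0 subr_eq0 => /eqP <-.
    by rewrite scalerA mulVf ?scale1r// gt_eqF// ltr_pwDl.
  by apply: Ce; rewrite ec; apply: CZ => //; rewrite invr_ge0 addr_ge0.
have [a a0 aC'] := convex_cone_halfspace cC' C'e.
have aC c : C c -> 0 <= dot a c.
  by move=> Cc; apply: aC'; exists c, 0, 0; split; rewrite ?mem0v// scale0r subr0 addr0.
have ae : dot a e <= 0.
  rewrite -oppr_ge0 -dotNr; apply: aC'.
  by exists 0, 1, 0; split; rewrite ?mem0v// scale1r add0r addr0.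
have aW w : w \in (V^C)%VS -> 0 <= dot a w.
  by move=> wV; apply: aC'; exists 0, 0, w; split => //; rewrite scale0r subr0 add0r.
have [k0 /[!inE] Kk0 mink0] : exists2 k, k \in K & forall k', k' \in K -> dot a k <= dot a k'.
  apply: EVT_min_rV => //; apply: continuous_subspaceT; exact: continuous_dot.
have aE x : E x -> 0 <= dot a x.
  move=> Ex; have [|k Kk [c /aC ac kc]] := KEC (k0 + x); first by exists k0 => //; exists x.
  have := mink0 k (mem_set Kk); move/(congr1 (dot a)): kc; rewrite !dotDr; lra.
have ae0 : dot a e = 0 by apply/eqP; rewrite eq_le ae aE.
have [W WP] := orthogonal_vspace a.
have dimVW : (\dim (V :&: W) < r)%N.
  apply: leq_trans (_ : \dim V <= r)%N; last by [].
  rewrite ltn_neqAle dimvS ?capvSl// andbT; apply/negP => VW.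
  have {VW} VW : (V <= W)%VS.
    have -> : V = (V :&: W)%VS by apply/esym/eqP; rewrite eqEdim capvSl (eqP VW) leqnn.
    exact: capvSr.
  move/negP: a0; apply; apply/eqP/dot_eq0.
  have : a \in (V + V^C)%VS by rewrite addv_complf memvf.
  move=> /memv_addP[v vV [w wV aE']].
  have av : dot a v = 0 by apply/eqP; rewrite -WP (subvP VW).
  have aw : dot a w = 0.
    by apply/eqP; rewrite eq_le aW// andbT -oppr_ge0 -dotNr aW ?memvN.
  by rewrite {2}aE' dotDr av aw addr0.
apply: Ce.
pose H : set 'rV[R]_n := [set x | dot a x = 0].
have cH X : convex_cone X -> convex_cone (X `&` H).
  move=> [X0 XD XZ]; split=> [|x y [Xx Hx] [Xy Hy]|t x t0 [Xx Hx]].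
  - by split; rewrite /H//= dot0r.
  - by split; [exact: XD|rewrite /H/= dotDr Hx Hy addr0].
  - by split; [exact: XZ|rewrite /H/= dotZr Hx mulr0].
suff /(_ e) : E `&` H `<=` C `&` H by case.
apply: (IH (K `&` [set x | dot a x = dot a k0]) _ _ (V :&: W)%VS) => //.
- by exists k0.
- by apply: compact_closedI => //; exact: closed_dot_eq.
- exact: cH.
- exact: cH.
- move=> _ [k [Kk /= ak] [x [Ex Hx] <-]].
  have [|k' Kk' [c Cc kc]] := KEC (k + x); first by exists k => //; exists x.
  have := mink0 k' (mem_set Kk'); have := aC _ Cc.
  move/(congr1 (dot a)): (kc); rewrite !dotDr Hx ak => kc' ac ak'.
  exists k'; first by split => //=; lra.
  by exists c => //; split => //; rewrite /H /=; lra.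
- by move=> x [Cx /= Hx]; rewrite /= memv_cap WP Hx eqxx andbT; exact: CV.
- by move=> x [Cx /= Hx]; rewrite /= memv_cap WP Hx eqxx andbT; exact: EV.
Qed.

End Separation.

(** * Mirkil's theorem *)

Section LocallyPolyhedral.
Context {R : realType} {n : nat}.
Implicit Types (C D : set 'rV[R]_n) (G A : seq 'rV[R]_n) (L : {vspace 'rV[R]_n}).

Lemma closed_polar_cone A : closed (polar_cone A).
Proof.
rewrite (_ : polar_cone A = \bigcap_(a in [set` A]) [set x | dot a x <= 0]).
  apply: closed_bigI => a _.
  apply: (@preimage_closed _ _ (dot a) [set y | y <= 0]); last exact: closed_le.
  by move=> x _; exact: continuous_dot.
by apply/seteqP; split.
Qed.

Lemma vspace_cone L : convex_cone [set` L].
Proof. by split=> [|x y xL yL|t x _ xL] /=; rewrite ?mem0v ?memvD ?memvZ. Qed.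

Lemma minkowski_sum_cone C D :
  convex_cone C -> convex_cone D -> convex_cone (minkowski_sum C D).
Proof.
move=> [C0 CD CZ] [D0 DD DZ]; split.
- by exists 0 => //; exists 0 => //; rewrite addr0.
- move=> _ _ [x Cx [y Dy <-]] [x' Cx' [y' Dy' <-]].
  by exists (x + x'); [exact: CD|exists (y + y'); [exact: DD|rewrite addrACA]].
- move=> t _ t0 [x Cx [y Dy <-]].
  by exists (t *: x); [exact: CZ|exists (t *: y); [exact: DZ|rewrite scalerDr]].
Qed.

Lemma vspace_conic L : exists G, [set` L] = conic G.
Proof.
exists (vbasis L ++ map -%R (vbasis L)); apply/seteqP; split=> [x xL|]; last first.
  apply: conic_min (vspace_cone L) _ => g; rewrite mem_cat => /orP[/vbasis_mem//|].
  by move=> /mapP[b /vbasis_mem bL ->]; rewrite /= memvN.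
set G := _ ++ _; have [G0 GD GZ] := conic_cone G.
rewrite (coord_vbasis xL); elim/big_ind : _ => // i _.
have bL : (vbasis L)`_i \in val (vbasis L) by rewrite mem_nth ?size_tuple.
have [c0|c0] := leP 0 (coord (vbasis L) i x).
  by apply: GZ => //; apply: conic_mem; rewrite mem_cat bL.
rewrite -[_ *: _]opprK -scalerN -scaleNr; apply: GZ; first by rewrite oppr_ge0 ltW.
by apply: conic_mem; rewrite mem_cat map_f ?orbT.
Qed.

Lemma closed_vspace L : closed [set` L].
Proof.
by have [G ->] := vspace_conic L; have [A ->] := weyl G; exact: closed_polar_cone.
Qed.

(** If the tangent cone [C + R u] is finitely generated, so is [C] near [u].  Its
    generators may be taken to be [u], [-u] and points of [C]; without [-u] they
    generate a cone [conic G'] inside [C].  The inequalities of [conic G'] that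
    are tight at [u] hold on [C + R u], and the other ones hold near [u]. *)
Lemma conic_near C u G : convex_cone C -> C u ->
  minkowski_sum C [set` <[u]>%VS] = conic G ->
  exists2 G', (forall g, g \in G' -> C g) & \forall x \near u, C x -> conic G' x.
Proof.
move=> cC Cu CG.
have /choice[f fP] g : exists c, conic G g -> C c /\ exists s, g = c + s *: u.
  have [|Gg] := pselect (conic G g); last by exists 0.
  by rewrite -{1}CG => -[c Cc [_ /vlineP[s ->] <-]]; exists c => _; split=> //; exists s.
exists (u :: map f G).
  by move=> g; rewrite inE => /predU1P[->//|/mapP[h /conic_mem/fP[? _] ->]].
have [A uA] := weyl (u :: map f G).
have near_u : \forall x \near u, forall a, a \in A -> dot a u < 0 -> dot a x < 0.
  apply: (@near_all _ _ (nbhs u) A (fun a x => dot a u < 0 -> dot a x < 0)) => a _.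
  have [au|au] := ltP (dot a u) 0; last exact: nearW.
  have : dot a @ u --> dot a u by exact: continuous_dot.
  by move=> /cvgr_lt/(_ _ au); apply: filterS.
near=> x => Cx; rewrite uA => a aA.
have : polar_cone A u by rewrite -uA; apply: conic_mem; rewrite inE eqxx.
move=> /(_ a aA); rewrite le_eqVlt => /predU1P[au|au]; last first.
  by apply/ltW; move: a aA au; near: x.
have : conic G x by rewrite -CG; exists x => //; exists 0; rewrite ?addr0//= mem0v.
move=> /(@conic_min _ _ (minkowski_sum (conic (u :: map f G)) [set` <[u]>%VS]))[].
- by apply: minkowski_sum_cone; [exact: conic_cone|exact: vspace_cone].
- move=> g gG; have [_ [s ->]] := fP _ (conic_mem gG).
  exists (f g); first by apply: conic_mem; rewrite inE map_f ?orbT.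
  by exists (s *: u) => //=; rewrite memvZ ?memv_line.
- rewrite uA => y Ay [_ /vlineP[s ->] <-].
  by rewrite dotDr dotZr au mulr0 addr0; exact: Ay.
Unshelve. all: end_near. Qed.

(** Mirkil's theorem, for sums with subspaces instead of projections.  The
    induction is on the codimension of [L]; the point [u] ranges over the unit
    vectors of [D + L] in a complement of [L], so that [L + R u] is larger. *)
Theorem closed_sums_conic D : convex_cone D ->
  (forall L, closed (minkowski_sum D [set` L])) ->
  forall L, exists G, minkowski_sum D [set` L] = conic G.
Proof.
move=> cD clD L; have [r Lr] := ubnP (\dim {:'rV[R]_n} - \dim L).
elim: r => // r IH in L Lr *.
set C := minkowski_sum D _.
have cC : convex_cone C by apply: minkowski_sum_cone => //; exact: vspace_cone.
have LC l x : l \in L -> C x -> C (x + l).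
  move=> lL [d Dd [l' l'L <-]]; exists d => //.
  by exists (l' + l); rewrite ?addrA//= memvD.
pose W := (L^C)%VS.
pose S := [set x | `|x| = 1] `&` (C `&` [set` W]).
have cS : compact S.
  apply: compact_closedI; first exact: compact_sphere.
  by apply: closedI; [exact: clD|exact: closed_vspace].
have [|s sC sS] := @compact_finite_choice _ _ S (fun G => forall g, g \in G -> C g)
   (fun x G => C x -> conic G x) cS.
  move=> u [u1 [Cu uW]].
  have uL : u \notin L.
    apply/negP => uL; have : u \in (L :&: W)%VS by rewrite memv_cap uL.
    rewrite capv_compl memv0 => /eqP u0; move: u1; rewrite /= u0 normr0 => /eqP.
    by rewrite eq_sym oner_eq0.
  have [|G LuG] := IH (L + <[u]>)%VS.
    have : (\dim L < \dim (L + <[u]>))%N.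
      rewrite ltn_neqAle dimvS ?addvSl// andbT; apply: contra uL => /eqP LL.
      have /eqP -> : L == (L + <[u]>)%VS by rewrite eqEdim addvSl LL leqnn.
      by rewrite memvE addvSr.
    by have := dimvS (subvf (L + <[u]>)); lia.
  apply: (@conic_near _ _ G) => //; rewrite -LuG.
  apply/seteqP; split=> x.
    move=> [_ [d Dd [l lL <-]] [v vu <-]]; exists d => //; exists (l + v).
      by rewrite /= memv_add.
    by rewrite addrA.
  move=> [d Dd [_ /memv_addP[l lL [v vu ->]] <-]]; exists (d + l).
    by exists d => //; exists l.
  by exists v => //; rewrite addrA.
have [GL LG] := vspace_conic L.
exists (GL ++ flatten s); apply/seteqP; split=> [x Cx|]; last first.
  apply: conic_min => // g; rewrite mem_cat => /orP[gL|/flattenP[G /sC GC /GC]//].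
  rewrite -[g]add0r; apply: LC; last by have [] := cC.
  by have := conic_mem gL; rewrite -LG.
have cG := conic_cone (GL ++ flatten s); have [G0 GD GZ] := cG.
have : x \in (L + W)%VS by rewrite addv_complf memvf.
move=> /memv_addP[l lL [w wW xlw]].
rewrite xlw; apply: GD.
  have : conic GL l by rewrite -LG.
  by apply: conic_min => // g gL; apply: conic_mem; rewrite mem_cat gL.
have Cw : C w.
  have -> : w = x + - l by rewrite xlw [l + w]addrC addrK.
  by apply: LC; rewrite ?memvN.
have [->//|w0] := eqVneq w 0.
have wp : 0 < `|w| by rewrite normr_gt0.
have Cw1 : C (`|w|^-1 *: w) by have [_ _ CZ] := cC; apply: CZ; rewrite ?invr_ge0.
have [|G Gs /(_ Cw1) Gw] := sS (`|w|^-1 *: w).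
  by split; [rewrite /= normrZ normfV normr_id mulVf ?gt_eqF|split=> //=; rewrite memvZ].
rewrite -[w]scale1r -(mulfV (lt0r_neq0 wp)) -scalerA; apply: GZ; first exact: ltW.
move: Gw; apply: conic_min => // g gG; apply: conic_mem.
by rewrite mem_cat; apply/orP; right; apply/flattenP; exists G.
Qed.

End LocallyPolyhedral.

(** * Asymptotes *)

Section Asymptotes.
Context {R : realType} {n : nat}.
Implicit Types (C D E F K M : set 'rV[R]_n) (A : seq 'rV[R]_n) (L : {vspace 'rV[R]_n}).

Lemma closed_convex_cone_cone D : closed_convex_cone D -> convex_cone D.
Proof.
move=> [[x0 Dx0] _ cvxD DZ]; split=> //; first by rewrite -(scale0r x0); exact: DZ.
move=> x y Dx Dy.
have h0 : 0 <= 2^-1 :> R by [].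
have h1 : 2^-1 <= 1 :> R by lra.
have /set_mem D2 := cvxD x y (Itv01 h0 h1) (mem_set Dx) (mem_set Dy).
have := DZ 2 _ (ler0n _ _) D2.
rewrite (_ : 2 *: _ = x + y)// /conv /= scalerDr !scalerA /unstable.onem /=.
have -> : 2 * 2^-1 = 1 :> R by rewrite mulfV.
have -> : 2 * (1 - 2^-1) = 1 :> R by lra.
by rewrite !scale1r.
Qed.

Lemma recession_cone_cone F : convex_cone (recession_cone F).
Proof.
split=> [x t Fx _|u v Fu Fv x t Fx t0|t u t0 Fu x s Fx s0].
- by rewrite scaler0 addr0.
- by rewrite scalerDr addrA; apply: Fv => //; exact: Fu.
- by rewrite scalerA; apply: Fu => //; rewrite mulr_ge0.
Qed.

(** The nontrivial inclusion is a cancellation of [K]: the translates by recession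
    directions of points of [K] stay in [K + D]. *)
Lemma recession_cone_minkowski K D : K !=set0 -> compact K -> convex_cone D ->
  recession_cone (minkowski_sum K D) = D.
Proof.
move=> K0 cK cD; have [D0 DD DZ] := cD; apply/seteqP; split=> [|u Du].
  apply: (compact_cone_cancel K0 cK cD (recession_cone_cone _)).
  move=> _ [k Kk [u Fu <-]]; rewrite -[u]scale1r; apply: Fu => //.
  by exists k => //; exists 0; rewrite ?addr0.
move=> _ t [k Kk [d Dd <-]] t0; exists k => //; exists (d + t *: u); last by rewrite addrA.
by apply: DD => //; exact: DZ.
Qed.

Lemma closure_cone C : convex_cone C -> convex_cone (closure C).
Proof.
move=> [C0 CD CZ]; split; first exact: subset_closure.
- move=> x y Cx Cy B /(@add_continuous _ (x, y))[[P Q] /= [Px Qy] PQB].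
  have [u [Cu Pu]] := Cx P Px; have [v [Cv Qv]] := Cy Q Qy.
  by exists (u + v); split; [exact: CD|exact: (PQB (u, v))].
- move=> t x t0 Cx B Btx.
  have [|u [Cu Bu]] := Cx ((fun z => t *: z) @^-1` B).
    by move: Btx; apply: (@scaler_continuous _ _ t x).
  by exists (t *: u); split => //; exact: CZ.
Qed.

Lemma minkowski_closure_sub K C :
  minkowski_sum K (closure C) `<=` closure (minkowski_sum K C).
Proof.
move=> _ [k Kk [x Cx <-]] B Bkx.
have [|u [Cu Bu]] := Cx ((fun z => k + z) @^-1` B).
  have : k + z @[z --> x] --> k + x.
    by apply: (@cvgD _ _ _ (nbhs x) _ (fun=> k) id) => //; exact: cvg_cst.
  by apply.
by exists (k + u); split => //; exists k => //; exists u.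
Qed.

Lemma minkowski_sumA (X Y Z : set 'rV[R]_n) :
  minkowski_sum (minkowski_sum X Y) Z = minkowski_sum X (minkowski_sum Y Z).
Proof.
apply/seteqP; split=> [_ [_ [x Xx [y Yy <-]] [z Zz <-]]|_ [x Xx [_ [y Yy [z Zz <-]] <-]]].
  by exists x => //; exists (y + z); rewrite ?addrA//; exists y => //; exists z.
by exists (x + y); [exists x => //; exists y|exists z; rewrite ?addrA].
Qed.

Lemma enorm_le x e : 0 <= e -> dot x x <= e ^+ 2 -> @enorm R n x <= e.
Proof.
move=> e0 xe; rewrite -[leRHS]ger0_norm// -sqrtr_sqr /enorm.
by rewrite ler_sqrt ?sqr_ge0.
Qed.

Lemma mx_norm_le_enorm (x : 'rV[R]_n) : `|x| <= enorm x.
Proof.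
rewrite -[leLHS]/(mx_norm x) mx_normrE; apply: bigmax_le => [|[i j] _ /=].
  exact: sqrtr_ge0.
rewrite ord1 -sqrtr_sqr ler_sqrt ?dot_ge0// dotE (bigD1 j)//= expr2 lerDl.
by rewrite sumr_ge0// => k _; rewrite -expr2 sqr_ge0.
Qed.

(** A point [p] in the closure of [F + L] but not in [F + L] would make [p + L] an
    f-asymptote. *)
Lemma closed_no_asymptote F : ~ (exists M, f_asymptote F M) ->
  forall L, closed (minkowski_sum F [set` L]).
Proof.
move=> noM L p clp; apply: contrapT => Fp; apply: noM.
exists [set p + v | v in [set` L]]; split; first by exists p, L.
  rewrite -subset0 => x [Fx [v vL pv]]; apply: Fp.
  by exists x => //; exists (- v); rewrite /= ?memvN// -pv addrK.
apply/eqP; rewrite eq_le; apply/andP; split; last first.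
  apply: le_ereal_inf_tmp => _ [x _ [y _ <-]]; rewrite lee_fin; exact: sqrtr_ge0.
apply/lee_addgt0Pr => e e0; rewrite add0e; apply: ereal_inf_le.
have pp : (fun z => dot (z - p) (z - p)) @ p --> (0 : R).
  rewrite -(dot0l (0 : 'rV[R]_n)) -(subrr p).
  apply: (@cvg_dot _ _ _ (nbhs p) _ (fun z => z - p) (fun z => z - p));
    by apply: (@cvgB _ _ _ (nbhs p) _ id (fun=> p)) => //; exact: cvg_cst.
have /clp[_ [[x Fx [l lL <-]] /= xl]] : \forall z \near p, dot (z - p) (z - p) < e ^+ 2.
  by move/cvgr_lt: pp; apply; rewrite exprn_gt0.
exists (enorm (x - (p - l)))%:E.
  by exists x => //; exists (p - l) => //; exists (- l); rewrite /= ?memvN.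
rewrite lee_fin enorm_le ?ltW// opprB addrA addrAC.
by move: xl; rewrite addrAC.
Qed.

(** For [C = D + L] the closedness of [F + L = K + C] gives
    [K + closure C `<=` K + C], and cancelling [K] shows that [C] is closed, as
    Mirkil's theorem requires. *)
Theorem no_asymptote_polar_cone F K D :
  K !=set0 -> compact K -> convex_cone D -> F = minkowski_sum K D ->
  ~ (exists M, f_asymptote F M) -> exists A, D = polar_cone A.
Proof.
move=> K0 cK cD FKD /closed_no_asymptote clF.
have [|G DG] := closed_sums_conic cD _ 0%VS; last first.
  have [A GA] := weyl G; exists A; rewrite -GA -DG.
  apply/seteqP; split=> [x Dx|_ [d Dd [v /= + <-]]].
    by exists x => //; exists 0; rewrite /= ?mem0v ?addr0.
  by rewrite memv0 => /eqP ->; rewrite addr0.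
move=> L; set C := minkowski_sum D _.
have cC : convex_cone C by apply: minkowski_sum_cone => //; exact: vspace_cone.
apply: (compact_cone_cancel K0 cK cC (closure_cone cC)).
apply: subset_trans (@minkowski_closure_sub _ _) _.
by rewrite -minkowski_sumA -FKD; exact: clF.
Qed.

Lemma polar_cone_polyhedral A : polyhedral (polar_cone A).
Proof.
pose B := [seq a <- A | a != 0].
exists (size B), (fun i => [set x | dot B`_i x <= 0]); split=> [i|].
  exists B`_i, 0; split => //.
  by have := mem_nth 0 (ltn_ord i); rewrite mem_filter => /andP[].
apply/seteqP; split=> [x Ax i _|x Bx a aA].
  by apply: Ax; have := mem_nth 0 (ltn_ord i); rewrite mem_filter => /andP[].
have [->|a0] := eqVneq a 0; first by rewrite dot0l.
have aB : a \in B by rewrite mem_filter a0.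
have iB : (index a B < size B)%N by rewrite index_mem.
by have := Bx (Ordinal iB) Logic.I; rewrite /= nth_index.
Qed.

(** As [D] contains 0 and is stable under scaling, the right-hand sides of the
    inequalities defining it can be replaced by 0. *)
Lemma polyhedral_cone_polar D : convex_cone D -> polyhedral D -> exists A, D = polar_cone A.
Proof.
move=> [D0 DD DZ] [m [H [hH DH]]].
have /choice[a aP] i : exists a : 'rV[R]_n, exists b, H i = [set x | dot a x <= b].
  by have [a [b [_ ->]]] := hH i; exists a, b.
have DHi x i : D x -> H i x by rewrite DH; apply.
exists (map a (enum 'I_m)); apply/seteqP; split=> x Dx.
  move=> _ /mapP[i _ ->]; have [b Hb] := aP i; rewrite leNgt; apply/negP => ax.
  have t0 : 0 <= (`|b| + 1) / dot (a i) x by rewrite divr_ge0 ?ltW// ltr_wpDl.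
  have := DHi _ i (DZ _ _ t0 Dx); rewrite Hb /= dotZr divfK ?gt_eqF//.
  by have := ler_norm b; lra.
rewrite DH => i _; have [b Hb] := aP i.
have := DHi _ i D0; rewrite Hb /= dot0r; apply: le_trans.
by apply: Dx; rewrite map_f ?mem_enum.
Qed.

(** The squared norm of [(x - p) P], where [P] projects along [L], is a quadratic
    function that vanishes exactly on [p + L]. *)
Theorem FW_no_asymptote F : FW_set F -> ~ exists M, f_asymptote F M.
Proof.
move=> FW [_ [[p [L ->]] FM dFM]].
pose P := 1%:M - lin1_mx (projv L).
have PE x : x *m P = x - projv L x by rewrite mulmxBr mulmx1 mul_rV_lin1.
pose f x := dot ((x - p) *m P) ((x - p) *m P).
have qf : quadratic f.
  pose S := P *m P^T.
  have dS x y : dot (x *m P) (y *m P) = dot (x *m S) y.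
    by rewrite /dot trmx_mul /S !mulmxA.
  have ST : S^T = S by rewrite trmx_mul trmxK.
  exists (2 *: S), (- (2 *: (p *m S))), (dot (p *m S) p); split.
    by rewrite linearZ /= ST.
  move=> x; rewrite /f !dS mulmxBl -/(dot (x *m (2 *: S)) x) -scalemxAr.
  rewrite !dot_linE (dot_sym_mx x p ST) mulrA mulVf// mul1r; lra.
have f0 x : 0 <= f x by exact: dot_ge0.
have lbf : has_lbound (f @` F) by exists 0 => _ [x _ <-].
have [x Fx fx] := FW f qf lbf.
have fxP : 0 < f x.
  rewrite lt_neqAle f0 andbT eq_sym; apply/eqP => /dot_eq0; rewrite PE => /eqP.
  rewrite subr_eq0 => /eqP xp; have : (F `&` [set p + v | v in [set` L]]) x.
    by split=> //; exists (x - p); [rewrite /= xp memv_proj|rewrite addrC subrK].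
  by rewrite FM.
have P0 : (fun z : 'rV[R]_n => dot (z *m P) (z *m P)) @ (0 : 'rV[R]_n) --> dot (0 *m P) (0 *m P).
  by apply: (@cvg_dot _ _ _ (nbhs (0 : 'rV[R]_n)) _ (fun z => z *m P) (fun z => z *m P));
    exact: (@cvg_mulmx _ _ _ (nbhs (0 : 'rV[R]_n)) _ P id).
have /nbhs_norm0P[e /= e0 Pe] : \forall z \near (0 : 'rV[R]_n), dot (z *m P) (z *m P) < f x.
  by move/cvgr_lt: P0; apply; rewrite mul0mx dot0l.
have [_ [y Fy [_ [v vL <-] <-]]] : exists2 d,
    [set (enorm (x - y))%:E | x in F & y in [set p + v | v in [set` L]]] d & (d < e%:E)%E.
  by apply: ereal_inf_lt; rewrite -/(set_dist _ _) dFM lte_fin.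
rewrite lte_fin => /(le_lt_trans (mx_norm_le_enorm _))/Pe.
suff -> : (y - (p + v)) *m P = (y - p) *m P.
  by rewrite ltNge fx ge_inf//; exists y.
by rewrite opprD addrA mulmxBl [v *m P]PE projv_id// subrr subr0.
Qed.

End Asymptotes.

(** * Quadratic functions on a compact set plus a polyhedral cone *)

Section FrankWolfe.
Context {R : realType} {n : nat}.
Implicit Types (K : set 'rV[R]_n) (A : seq 'rV[R]_n).

Lemma quadratic_dominates_linear (al be ga : R) : 0 < al ->
  exists B, forall t, B < t -> be * t + ga < al * t ^+ 2.
Proof.
move=> al0; exists (1 + (`|be| + `|ga|) / al) => t.
have := ler_norm be; have := ler_norm ga; have := normr_ge0 be; have := normr_ge0 ga.
move: `|be| `|ga| => b g g0 b0 gag beb.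
set q := (b + g) / al => qt.
have q0 : 0 <= q by rewrite divr_ge0 ?addr_ge0// ltW.
have qal : q * al = b + g by rewrite divfK ?gt_eqF.
have bt : be * t <= b * t by rewrite ler_wpM2r//; lra.
have gt : g <= g * t by rewrite ler_peMr//; lra.
have tt : q * al * t < t * al * t.
  by rewrite ltr_pM2r ?ltr_pM2r//; lra.
rewrite qal in tt; rewrite expr2; nra.
Qed.

Context (Q : 'M[R]_n) (b : 'rV[R]_n) (c : R) (QT : Q^T = Q).
Let f x := 2^-1 * dot (x *m Q) x + dot b x + c.

Lemma quadratic_line x h t :
  f (x + t *: h) = f x + t * (dot (x *m Q) h + dot b h) + 2^-1 * dot (h *m Q) h * t ^+ 2.
Proof.
by rewrite /f mulmxDl -scalemxAl !dot_linE (dot_sym_mx h x QT); lra.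
Qed.

(** The shortening argument.  It compares [y k] with [y k - h] for a limit
    direction [h]: the squared length drops by [2 * dot (y k) h - dot h h], which
    tends to infinity with [y k], so it is enough that [y k] be shortest up to an
    error 1. *)
Lemma polar_cone_FW K A : K !=set0 -> compact K ->
  has_lbound (f @` minkowski_sum K (polar_cone A)) ->
  exists2 x, minkowski_sum K (polar_cone A) x &
    f x = inf (f @` minkowski_sum K (polar_cone A)).
Proof.
move=> [x0 Kx0] cK; set D := polar_cone A; set F := minkowski_sum K D => lbf.
have [D0 DD DZ] : convex_cone D := polar_cone_cone A.
have FD z h t : F z -> D h -> 0 <= t -> F (z + t *: h).
  move=> [x Kx [y Dy <-]] Dh t0; exists x => //; exists (y + t *: h); rewrite ?addrA//.
  by apply: DD => //; exact: DZ.
have Fx0 : F x0 by exists x0 => //; exists 0; rewrite ?addr0.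
set m := inf _.
have fm z : F z -> m <= f z by move=> Fz; apply: ge_inf => //; exists z.
suff [z Fz fz] : exists2 z, F z & f z <= m.
  by exists z => //; apply/eqP; rewrite eq_le fz fm.
have infF : has_inf (f @` F) by split => //; exists (f x0), x0.
have /choice[xy xyP] (k : nat) : exists p : 'rV[R]_n * 'rV[R]_n,
    [/\ K p.1, D p.2, f (p.1 + p.2) <= m + k.+1%:R^-1 &
      forall y, D y -> f (p.1 + y) <= m + k.+1%:R^-1 -> dot p.2 p.2 < dot y y + 1].
  pose N := [set dot p.2 p.2 | p in
    [set p | [/\ K p.1, D p.2 & f (p.1 + p.2) <= m + k.+1%:R^-1]]].
  have k0 : 0 < k.+1%:R^-1 :> R by rewrite invr_gt0.
  have lbN : has_lbound N by exists 0 => _ [p _ <-]; exact: dot_ge0.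
  have infN : has_inf N.
    split => //; have [_ [_ [x Kx [y Dy <-]] <-] fxy] := inf_adherent k0 infF.
    by exists (dot y y), (x, y) => //; split => //; exact: ltW.
  have [_ [p [Kp Dp fp] <-] pN] := inf_adherent ltr01 infN.
  exists p; split=> // y Dy fy; apply: lt_le_trans pN _; rewrite lerD2r.
  by apply: ge_inf => //; exists (p.1, y).
pose x k := (xy k).1; pose y k := (xy k).2.
(* [U] is an ultrafilter on [nat] containing the cofinite sets. *)
have [U [UU ooU]] := ultraFilterLemma (F := \oo) _.
have Kx k : K (x k) by have [] := xyP k.
have Dy k : D (y k) by have [] := xyP k.
have fk k : f (x k + y k) <= m + k.+1%:R^-1 by have [] := xyP k.
have yk k y' : D y' -> f (x k + y') <= m + k.+1%:R^-1 -> dot (y k) (y k) < dot y' y' + 1.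
  by have [_ _ _] := xyP k; apply.
have [xb Kxb xxb] : exists2 p, K p & x @ U --> p.
  by apply: compact_ultra_cvg => //; exact: nearW.
have cvgf z l : z @ U --> l -> f (z k) @[k --> U] --> f l.
  move=> zl; apply: cvgD; last exact: cvg_cst.
  apply: cvgD; first by apply: cvgMl_tmp; apply: cvg_dot => //; exact: cvg_mulmx.
  by apply: cvg_dot => //; exact: cvg_cst.
have [[B yB]|unbd] := pselect (exists B, \forall k \near U, `|y k| <= B).
  have [yb [_ Dyb] yyb] : exists2 p, ([set p | `|p| <= B] `&` D) p & y @ U --> p.
    apply: compact_ultra_cvg; last by move: yB; apply: filterS.
    by apply: compact_closedI; [exact: compact_ball|exact: closed_polar_cone].
  exists (xb + yb); first by exists xb => //; exists yb.
  apply/ler_addgt0Pr => e e0.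
  apply: (@cvgr_to_le _ U _ _ (fun k => f (x k + y k))).
    by apply: cvgf; exact: cvgD.
  have : \forall k \near U, k.+1%:R^-1 < e.
    exact/ooU/(near_infty_natSinv_lt (PosNum e0)).
  by apply: filterS => k ke; apply: le_trans (fk k) _; rewrite lerD2l ltW.
have yoo B : \forall k \near U, B < `|y k|.
  have [yB|] := @in_ultra_setVsetC _ U [set k | `|y k| <= B] UU.
    by exfalso; apply: unbd; exists B.
  by apply: filterS => k /= /negP; rewrite -ltNge.
pose u k := `|y k|^-1 *: y k.
have yu : \forall k \near U, 0 < `|y k| /\ y k = `|y k| *: u k.
  apply: filterS (yoo 0) => k yk0; split=> //.
  by rewrite /u scalerA mulfV ?scale1r// gt_eqF.
have [h h1 uh] : exists2 h, `|h| = 1 & u @ U --> h.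
  apply: compact_ultra_cvg; first exact: compact_sphere.
  apply: filterS (yoo 0) => k yk0.
  by rewrite /u /= normrZ normfV normr_id mulVf ?gt_eqF.
have Dh : D h.
  apply: (@closed_cvg _ _ U _ u D (@closed_polar_cone _ _ A) _ h uh); apply: nearW => k.
  by apply: DZ; rewrite ?invr_ge0.
have hh : 0 < dot h h by rewrite dot_gt0// -normr_eq0 h1 oner_eq0.
pose r z := dot (z *m Q) h + dot b h.
pose q := dot (h *m Q) h.
have line z t : F z -> 0 <= t -> m <= f z + t * r z + 2^-1 * q * t ^+ 2.
  by move=> Fz t0; rewrite -quadratic_line; apply: fm; exact: FD.
(* Otherwise [f] would tend to -oo along the ray from [x0] in direction [h]. *)
have q_ge0 : 0 <= q.
  rewrite leNgt; apply/negP => q0.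
  have [|B Bt] := @quadratic_dominates_linear (- (2^-1 * q)) (r x0) (f x0 - m).
    by rewrite oppr_gt0 pmulr_rlt0.
  pose t := `|B| + 1.
  have t0 : 0 <= t by rewrite addr_ge0.
  have /Bt : B < t by rewrite /t; have := ler_norm B; lra.
  by have := line x0 t Fx0 t0; lra.
(* Otherwise [f (x k + y k)] would grow like the square of [`|y k|]. *)
have q_le0 : q <= 0.
  rewrite leNgt; apply/negP => q0.
  pose rh k := dot (x k *m Q) (u k) + dot b (u k).
  have rhr : rh k @[k --> U] --> r xb.
    by apply: cvgD; apply: cvg_dot => //; [exact: cvg_mulmx|exact: cvg_cst].
  pose qh k := dot (u k *m Q) (u k).
  have qhq : qh k @[k --> U] --> q by apply: cvg_dot => //; exact: cvg_mulmx.
  have [|B Bt] := @quadratic_dominates_linear (2^-1 * (q / 2)) (1 - r xb) (m + 2 - f xb).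
    by rewrite mulr_gt0 ?divr_gt0.
  have : \forall k \near U, False.
    have qhk : \forall k \near U, q / 2 < qh k by move/cvgr_gt: qhq; apply; lra.
    have rhk : \forall k \near U, r xb - 1 < rh k by move/cvgr_gt: rhr; apply; lra.
    have fxk : \forall k \near U, f xb - 1 < f (x k).
      by move/cvgr_gt: (cvgf _ _ xxb); apply; lra.
    near=> k.
    have [yk0 yE] : 0 < `|y k| /\ y k = `|y k| *: u k by near: k.
    have /Bt : B < `|y k| by near: k.
    have := fk k; rewrite {1}yE quadratic_line -/(rh k) -/(qh k).
    have : q / 2 < qh k by near: k.
    have : r xb - 1 < rh k by near: k.
    have : f xb - 1 < f (x k) by near: k.
    have : k.+1%:R^-1 <= 1 :> R by rewrite invf_le1 ?ler1n.
    move: `|y k| yk0 (rh k) (qh k) (f (x k)) (k.+1%:R^-1) => N N0 rk qk fxk' ik.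
    move=> ik1 fk1 rk1 qk1 fle Blt.
    have : N * (r xb - 1) <= N * rk by rewrite ler_pM2l// ltW.
    have : 2^-1 * (q / 2) * N ^+ 2 <= 2^-1 * qk * N ^+ 2.
      by rewrite ler_pM2r ?exprn_gt0// ler_pM2l// ltW.
    lra.
  exact: filter_not_empty.
have q0 : q = 0 by apply/eqP; rewrite eq_le q_le0 q_ge0.
(* As [q = 0], [r z] is the constant slope of [f] along the ray from [z] in
   direction [h]. *)
have r_ge0 z : F z -> 0 <= r z.
  move=> Fz; rewrite leNgt; apply/negP => rz.
  pose t := (f z - m + 1) / - r z.
  have t0 : 0 <= t by rewrite divr_ge0//; have := fm z Fz; lra.
  have tr : t * r z = - (f z - m + 1).
    by rewrite -[X in _ * X]opprK mulrN divfK// oppr_eq0 lt_eqF.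
  by have := line z t Fz t0; rewrite q0 tr; lra.
have : \forall k \near U, False.
  have uhk : \forall k \near U, dot h h / 2 < dot (u k) h.
    have : dot (u k) h @[k --> U] --> dot h h by apply: cvg_dot => //; exact: cvg_cst.
    by move/cvgr_gt; apply; lra.
  have Dyh : \forall k \near U, D (y k - h).
    apply: (@near_all _ _ U A (fun a k => dot a (y k - h) <= 0)) => a aA.
    have := Dh a aA; rewrite le_eqVlt => /predU1P[ah|ah].
      by apply: nearW => k; rewrite !dot_linE ah subr0; exact: Dy.
    have auh : \forall k \near U, dot a (u k) < dot a h / 2.
      have : dot a (u k) @[k --> U] --> dot a h by apply: cvg_dot => //; exact: cvg_cst.
      by move/cvgr_lt; apply; lra.
    near=> k; have [yk0 yE] : 0 < `|y k| /\ y k = `|y k| *: u k by near: k.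
    have y2 : 2 < `|y k| by near: k.
    have au : dot a (u k) < dot a h / 2 by near: k.
    rewrite dotDr dotNr {1}yE dotZr.
    have : `|y k| * dot a (u k) < `|y k| * (dot a h / 2) by rewrite ltr_pM2l.
    have : 0 <= (`|y k| - 2) * (- dot a h) by apply: mulr_ge0; lra.
    lra.
  near=> k.
  have [yk0 yE] : 0 < `|y k| /\ y k = `|y k| *: u k by near: k.
  have Dk : D (y k - h) by near: k.
  have : dot (y k) (y k) < dot (y k - h) (y k - h) + 1.
    apply: yk => //; apply: le_trans (fk k).
    rewrite addrA -scaleN1r quadratic_line -/q q0 mulr0 mul0r addr0 mulN1r.
    rewrite lerBlDr lerDl; apply: r_ge0.
    by exists (x k) => //; exists (y k).
  have uk : dot h h / 2 < dot (u k) h by near: k.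
  have Nk : 1 + (dot h h)^-1 < `|y k| by near: k.
  have yh : dot (y k) h = `|y k| * dot (u k) h by rewrite {1}yE dotZl.
  have : dot h h + 1 < `|y k| * dot h h.
    rewrite -[X in X < _](_ : (1 + (dot h h)^-1) * dot h h = _) ?ltr_pM2r//.
    by rewrite mulrDl mul1r mulVf// gt_eqF.
  have : `|y k| * (dot h h / 2) < `|y k| * dot (u k) h by rewrite ltr_pM2l.
  by move=> Nu Nh; rewrite !dot_linE (dotC h (y k)) yh; lra.
by move=> /filter_not_empty.
Unshelve. all: end_near. Qed.

End FrankWolfe.

Theorem theorem2 (R : realType) (n : nat) (F : set 'rV[R]_n)
    (F0 : F !=set0) (hF : motzkin_set F) :
  (FW_set F <-> polyhedral (recession_cone F)) /\
  (polyhedral (recession_cone F) <->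
     ~ exists M : set 'rV[R]_n, f_asymptote F M).
Proof.
have [_ [K [D [cK /closed_convex_cone_cone cD FKD]]]] := hF.
have K0 : K !=set0 by case: F0 => x; rewrite FKD => -[k Kk _]; exists k.
have -> : recession_cone F = D by rewrite FKD recession_cone_minkowski.
have asym_poly : ~ (exists M, f_asymptote F M) -> polyhedral D.
  by move=> /(no_asymptote_polar_cone K0 cK cD FKD)[A ->]; exact: polar_cone_polyhedral.
have poly_FW : polyhedral D -> FW_set F.
  move=> /(polyhedral_cone_polar cD)[A DA] f [Q [b [c [QT fE]]]].
  rewrite FKD DA (funext fE : f = fun x => 2^-1 * dot (x *m Q) x + dot b x + c).
  exact: polar_cone_FW.
have FW_asym := @FW_no_asymptote R n F.
by split; split=> H; auto.
Qed.
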